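(* Let $\Omega=\{a,b\}$ be a set of cardinality two. There are exactly 13 structures of diassociative semigroup on $\Omega$, which restrict to 8 up to isomorphism, and exactly 45 structures of extended diassociative semigroup (EDS) on $\Omega$, which restrict to 24 up to isomorphism. Representatives of the 8 isomorphism classes of diassociative semigroups $(\leftarrow,\rightarrow)$ are A $=(c_a,c_a)$, B $=(c_a,p_2)$, C $=(\min,\min)$, D $=(p_1,c_a)$, E $=(p_1,p_1)$, F $=(p_1,p_2)$, G $=(p_2,p_2)$, H $=(m_1,m_1)$, and representatives of the 24 isomorphism classes of EDS are obtained by adding the following pairs $(\triangleleft,\triangleright)$: - A: $(c_a,c_a)$, $(p_2,p_1)$; - B: $(c_a,c_a)$, $(p_2,p_1)$; - C: $(c_a,c_a)$, $(c_a,c_b)$, $(p_2,p_1)$, $(c_b,c_a)$, $(c_b,c_b)$; - D: $(c_a,c_a)$, $(p_2,p_1)$; - E: $(c_a,c_a)$, $(c_a,c_b)$, $(p_2,p_1)$; - F: $(c_a,c_a)$, $(c_a,c_b)$, $(p_2,p_1)$, $(m_1,m_1)$, $(m_1,m_2)$; - G: $(c_a,c_a)$, $(c_a,c_b)$, $(p_2,p_1)$; - H: $(c_a,c_a)$, $(p_2,p_1)$. Exactly four of these 24 EDS are nondegenerate: F with $(p_2,p_1)$, F with $(m_1,m_1)$, F with $(m_1,m_2)$, and H with $(p_2,p_1)$.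
   Context: Binary operations on $\{a,b\}$ used: $c_a$, $c_b$ are the constant operations with value $a$, resp. $b$; $p_1(x,y)=x$; $p_2(x,y)=y$; $\min$ is the operation with $\min(b,b)=b$ and value $a$ on all other pairs; $m_1(x,y)=a$ if $x=y$ and $b$ otherwise; $m_2(x,y)=b$ if $x=y$ and $a$ otherwise. Extended diassociative semigroups. A diassociative semigroup is a set $\Omega$ with maps $\leftarrow,\rightarrow:\Omega\times\Omega\to\Omega$ such that for all $\alpha,\beta,\gamma\in\Omega$: $(\alpha\leftarrow\beta)\leftarrow\gamma=\alpha\leftarrow(\beta\leftarrow\gamma)=\alpha\leftarrow(\beta\rightarrow\gamma)$; $(\alpha\rightarrow\beta)\leftarrow\gamma=\alpha\rightarrow(\beta\leftarrow\gamma)$; $(\alpha\rightarrow\beta)\rightarrow\gamma=(\alpha\leftarrow\beta)\rightarrow\gamma=\alpha\rightarrow(\beta\rightarrow\gamma)$. An extended diassociative semigroup (EDS) is $(\Omega,\leftarrow,\rightarrow,\triangleleft,\triangleright)$ such that $(\Omega,\leftarrow,\rightarrow)$ is a diassociative semigroup and for all $\alpha,\beta,\gamma\in\Omega$: $\alpha\triangleright(\beta\leftarrow\gamma)=\alpha\triangleright\beta$; $(\alpha\rightarrow\beta)\triangleleft\gamma=\beta\triangleleft\gamma$; $(\alpha\triangleleft\beta)\leftarrow((\alpha\leftarrow\beta)\triangleleft\gamma)=\alpha\triangleleft(\beta\leftarrow\gamma)$; $(\alpha\triangleleft\beta)\triangleleft((\alpha\leftarrow\beta)\triangleleft\gamma)=\beta\triangleleft\gamma$;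 $(\alpha\triangleleft\beta)\rightarrow((\alpha\leftarrow\beta)\triangleleft\gamma)=\alpha\triangleleft(\beta\rightarrow\gamma)$; $(\alpha\triangleleft\beta)\triangleright((\alpha\leftarrow\beta)\triangleleft\gamma)=\beta\triangleright\gamma$; $(\alpha\triangleright(\beta\rightarrow\gamma))\leftarrow(\beta\triangleright\gamma)=(\alpha\leftarrow\beta)\triangleright\gamma$; $(\alpha\triangleright(\beta\rightarrow\gamma))\triangleleft(\beta\triangleright\gamma)=\alpha\triangleleft\beta$; $(\alpha\triangleright(\beta\rightarrow\gamma))\rightarrow(\beta\triangleright\gamma)=(\alpha\rightarrow\beta)\triangleright\gamma$; $(\alpha\triangleright(\beta\rightarrow\gamma))\triangleright(\beta\triangleright\gamma)=\alpha\triangleright\beta$. It is nondegenerate if the maps $(\alpha,\beta)\mapsto(\alpha\leftarrow\beta,\alpha\triangleleft\beta)$ and $(\alpha,\beta)\mapsto(\alpha\rightarrow\beta,\alpha\triangleright\beta)$ from $\Omega^2$ to $\Omega^2$ are bijective. Isomorphisms are bijections compatible with all the operations. *)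

(* Defs.v *)
From mathcomp Require Import all_boot.
From mathcomp Require Import boolp.

Set Implicit Arguments.
Unset Strict Implicit.
Unset Printing Implicit Defensive.

(* Throughout, l, r, tl, tr stand for the operations usually written as a left
   arrow, a right arrow, a left triangle and a right triangle. *)

Record diassociative (T : Type) (l r : T -> T -> T) : Prop := Diassociative {
  dias_ll_l : forall x y z, l (l x y) z = l x (l y z);
  dias_l_lr : forall x y z, l x (l y z) = l x (r y z);
  dias_rl_l : forall x y z, l (r x y) z = r x (l y z);
  dias_rr_lr : forall x y z, r (r x y) z = r (l x y) z;
  dias_lr_r : forall x y z, r (l x y) z = r x (r y z)
}.

Record extended_diassociative (T : Type) (l r tl tr : T -> T -> T) : Prop :=
  ExtendedDiassociative {
  eds_dias : diassociative l r;
  eds_tr_l : forall x y z, tr x (l y z) = tr x y;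
  eds_r_tl : forall x y z, tl (r x y) z = tl y z;
  eds_tl_l : forall x y z, l (tl x y) (tl (l x y) z) = tl x (l y z);
  eds_tl_tl : forall x y z, tl (tl x y) (tl (l x y) z) = tl y z;
  eds_tl_r : forall x y z, r (tl x y) (tl (l x y) z) = tl x (r y z);
  eds_tl_tr : forall x y z, tr (tl x y) (tl (l x y) z) = tr y z;
  eds_tr_l_tr : forall x y z, l (tr x (r y z)) (tr y z) = tr (l x y) z;
  eds_tr_tl_tr : forall x y z, tl (tr x (r y z)) (tr y z) = tl x y;
  eds_tr_r_tr : forall x y z, r (tr x (r y z)) (tr y z) = tr (r x y) z;
  eds_tr_tr_tr : forall x y z, tr (tr x (r y z)) (tr y z) = tr x y
}.

Definition nondegenerate_ops (T : Type) (l r tl tr : T -> T -> T) : Prop :=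
  bijective (fun p : T * T => (l p.1 p.2, tl p.1 p.2)) /\
  bijective (fun p : T * T => (r p.1 p.2, tr p.1 p.2)).

(* Operations on a finite type are finite functions, so that they can be
   counted and so that equality of operations is pointwise equality. *)
Definition binop (T : finType) := {ffun T * T -> T}.

(* A pair (l, r). *)
Definition dias_data (T : finType) := (binop T * binop T)%type.

(* A pair ((l, r), (tl, tr)). *)
Definition eds_data (T : finType) := (dias_data T * (binop T * binop T))%type.

Definition is_dias (T : finType) (D : dias_data T) : Prop :=
  diassociative (curry D.1) (curry D.2).

Definition is_eds (T : finType) (E : eds_data T) : Prop :=
  extended_diassociative (curry E.1.1) (curry E.1.2) (curry E.2.1) (curry E.2.2).

Definition nondegenerate (T : finType) (E : eds_data T) : Prop :=
  nondegenerate_ops (curry E.1.1) (curry E.1.2) (curry E.2.1) (curry E.2.2).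

Definition op_morph (T1 T2 : finType) (f : T1 -> T2)
    (o1 : binop T1) (o2 : binop T2) : Prop :=
  forall x y, f (o1 (x, y)) = o2 (f x, f y).

Definition dias_isomorphic (T1 T2 : finType)
    (D1 : dias_data T1) (D2 : dias_data T2) : Prop :=
  exists f : T1 -> T2,
    [/\ bijective f, op_morph f D1.1 D2.1 & op_morph f D1.2 D2.2].

Definition eds_isomorphic (T1 T2 : finType)
    (E1 : eds_data T1) (E2 : eds_data T2) : Prop :=
  exists f : T1 -> T2,
    [/\ bijective f,
        op_morph f E1.1.1 E2.1.1, op_morph f E1.1.2 E2.1.2,
        op_morph f E1.2.1 E2.2.1 & op_morph f E1.2.2 E2.2.2].

Definition dias_structures (T : finType) : {set dias_data T} :=
  [set D | `[< is_dias D >]].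

Definition eds_structures (T : finType) : {set eds_data T} :=
  [set E | `[< is_eds E >]].

Definition dias_classes (T : finType) : {set {set dias_data T}} :=
  equivalence_partition
    (fun D1 D2 => `[< dias_isomorphic D1 D2 >]) (dias_structures T).

Definition eds_classes (T : finType) : {set {set eds_data T}} :=
  equivalence_partition
    (fun E1 E2 => `[< eds_isomorphic E1 E2 >]) (eds_structures T).

Definition cst_op (T : finType) (c : T) : binop T := [ffun=> c].
Definition p1_op (T : finType) : binop T := [ffun p => p.1].
Definition p2_op (T : finType) : binop T := [ffun p => p.2].
Definition min_op (T : finType) (a b : T) : binop T :=
  [ffun p => if p == (b, b) then b else a].
Definition m1_op (T : finType) (a b : T) : binop T :=
  [ffun p => if p.1 == p.2 then a else b].
Definition m2_op (T : finType) (a b : T) : binop T :=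
  [ffun p => if p.1 == p.2 then b else a].

(* Main.v *)
Require Import Defs.
From mathcomp Require Import all_boot.
From mathcomp Require Import boolp.

(* Operations on a two-element set are encoded by boolean tables, a being read
   as false and b as true, on which all the axioms can be decided by computation.
   The only nontrivial bijection exchanges a and b, so an isomorphism class is
   an orbit of the conjugation of tables by negation, and it remains to count the
   tables satisfying the axioms and the orbits. *)

Set Implicit Arguments.
Unset Strict Implicit.
Unset Printing Implicit Defensive.

(** * Orbits of an involution acting on codes *)

Section OrbitClassification.
Variables (K : eqType) (T : finType) (dec : K -> T) (s : K -> K) (R : rel T).
Variables (S : {set T}) (L reps : seq K).
Hypothesis dec_inj : injective dec.
Hypothesis sK : involutive s.
Hypothesis RE : forall k l, R (dec k) (dec l) = (k == l) || (k == s l).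
Hypothesis S_dec : S = [set:: map dec L].
Hypothesis reps_uniq : uniq reps.
Hypothesis reps_L : all [in L] reps.
Hypothesis reps_cover : all (fun k => (k \in reps) || (s k \in reps)) L.
Hypothesis reps_sep : all (fun k => (s k \in reps) ==> (s k == k)) reps.

Lemma card_set_map_dec (r : seq K) : uniq r -> #|[set:: map dec r]| = size r.
Proof.
move=> r_uniq; rewrite cardsE -(size_map dec).
by apply/card_uniqP; rewrite map_inj_uniq.
Qed.

Let mem_dec (k : K) (r : seq K) : (dec k \in [set:: map dec r]) = (k \in r).
Proof. by rewrite inE mem_map. Qed.

(** By [RE], [R] relates two codes exactly when they lie in one orbit of [s]. Replacing [l] by [s l]
    only swaps the two disjuncts, since [s] is an involution. *)
Lemma orbit_equivalence : {in S & &, equivalence_rel R}.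
Proof.
move=> x y z; rewrite S_dec !inE => /mapP[k _ ->] /mapP[l _ ->] /mapP[m _ ->].
rewrite !RE eqxx; split=> // /orP[]/eqP-> //.
by rewrite (inj_eq (can_inj sK)) (can2_eq sK sK) orbC.
Qed.

(** [reps_cover] puts a representative in every orbit. [reps_sep] makes it unique: if an orbit
    contained [n] and [s n] both listed, then [n] would be a fixed point. *)
Lemma orbit_transversal :
  is_transversal [set:: map dec reps] (equivalence_partition R S) S.
Proof.
apply/and3P; split.
- exact: equivalence_partitionP orbit_equivalence.
- rewrite S_dec; apply/subsetP=> x; rewrite !inE => /mapP[k k_reps ->].
  by rewrite mem_map //; apply: (allP reps_L).
apply/forall_inP=> _ /imsetP[x xS ->].
have [k kL def_x] : exists2 k, k \in L & x = dec k.
  by move: xS; rewrite S_dec inE => /mapP[k]; exists k.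
have [m m_reps km] : exists2 m, m \in reps & (k == m) || (k == s m).
  have /orP[k_reps | sk_reps] := allP reps_cover k kL; first by exists k; rewrite ?eqxx.
  by exists (s k); rewrite // sK eqxx orbT.
rewrite (_ : _ :&: _ = [set dec m]) ?cards1 //; apply/setP=> y; rewrite !inE.
apply/andP/eqP=> [[/mapP[n n_reps ->]] | ->].
  rewrite def_x RE => /andP[_ kn]; congr dec.
  (* In the two mixed cases below, [m] and [n] are exchanged by [s], so [n] is fixed by [s] and
     equals [m]. *)
  have n_fix : s n \in reps -> s n = n.
    by move=> sn; apply/eqP/(implyP (allP reps_sep n n_reps)).
  case/orP: kn => /eqP kn; case/orP: km => /eqP km; rewrite kn in km => //.
  - by rewrite -[m]sK -km n_fix // km sK.
  - by rewrite -km n_fix // km.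
  exact: can_inj sK _ _ km.
rewrite map_f // S_dec inE mem_map // (allP reps_L) //.
by rewrite def_x RE.
Qed.

Lemma card_orbit_classes : #|equivalence_partition R S| = size reps.
Proof. by rewrite -(card_transversal orbit_transversal) card_set_map_dec. Qed.

End OrbitClassification.

(** * Pulling the axioms back along injective morphisms *)

Lemma diassociative_inj (T1 T2 : Type) (f : T1 -> T2) (l r : T1 -> T1 -> T1)
    (l' r' : T2 -> T2 -> T2) :
    injective f -> {morph f : x y / l x y >-> l' x y} ->
    {morph f : x y / r x y >-> r' x y} ->
  diassociative l' r' -> diassociative l r.
Proof.
move=> f_inj fl fr [h1 h2 h3 h4 h5].
by split=> x y z; apply: f_inj; rewrite ?(fl, fr).
Qed.

Lemma extended_diassociative_inj (T1 T2 : Type) (f : T1 -> T2)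
    (l r tl tr : T1 -> T1 -> T1) (l' r' tl' tr' : T2 -> T2 -> T2) :
    injective f -> {morph f : x y / l x y >-> l' x y} ->
    {morph f : x y / r x y >-> r' x y} -> {morph f : x y / tl x y >-> tl' x y} ->
    {morph f : x y / tr x y >-> tr' x y} ->
  extended_diassociative l' r' tl' tr' -> extended_diassociative l r tl tr.
Proof.
move=> f_inj fl fr ftl ftr [h0 h1 h2 h3 h4 h5 h6 h7 h8 h9 h10].
split=> [|x y z|x y z|x y z|x y z|x y z|x y z|x y z|x y z|x y z|x y z].
  exact: diassociative_inj fl fr h0.
all: by apply: f_inj; rewrite ?(fl, fr, ftl, ftr).
Qed.

(** Bijectivity is not equational, but on a finite type it reduces to injectivity, which pulls back
    along [f] applied to both coordinates. *)
Lemma nondegenerate_ops_inj (T1 T2 : finType) (f : T1 -> T2)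
    (l r tl tr : T1 -> T1 -> T1) (l' r' tl' tr' : T2 -> T2 -> T2) :
    injective f -> {morph f : x y / l x y >-> l' x y} ->
    {morph f : x y / r x y >-> r' x y} -> {morph f : x y / tl x y >-> tl' x y} ->
    {morph f : x y / tr x y >-> tr' x y} ->
  nondegenerate_ops l' r' tl' tr' -> nondegenerate_ops l r tl tr.
Proof.
move=> f_inj fl fr ftl ftr [/bij_inj inj1 /bij_inj inj2].
split; apply: injF_bij => -[x y] [x' y'] /= [e1 e2].
  have [] : (f x, f y) = (f x', f y') by apply: inj1; rewrite /= -!fl -!ftl e1 e2.
  by move=> /f_inj-> /f_inj->.
have [] : (f x, f y) = (f x', f y') by apply: inj2; rewrite /= -!fr -!ftr e1 e2.
by move=> /f_inj-> /f_inj->.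
Qed.

(** * Boolean tables *)

Definition table := (bool * bool * bool * bool)%type.

Definition tapp (c : table) (x y : bool) : bool :=
  let: (aa, ab, ba, bb) := c in
  if x then if y then bb else ba else if y then ab else aa.

Definition tabulate (f : bool -> bool -> bool) : table :=
  (f false false, f false true, f true false, f true true).

(** Explicit lists, so that the quantifiers and filters built on them evaluate under
    [vm_compute]. *)
Definition bools := [:: false; true].

Definition bool_pairs := [seq (x, y) | x <- bools, y <- bools].

Definition tables : seq table :=
  [seq (p, q.1, q.2) | p <- bool_pairs, q <- bool_pairs].

(** Transport along the self-inverse bijection [addb e]: both bijections of the booleans are covered
    at once, [false] giving the identity and [true] the exchange. *)
Definition tconj (e : bool) (c : table) : table :=
  tabulate (fun x y => e (+) tapp c (e (+) x) (e (+) y)).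

Lemma tapp_tabulate (f : bool -> bool -> bool) : tapp (tabulate f) =2 f.
Proof. by case=> -[]. Qed.

Lemma tapp_inj (c d : table) : tapp c =2 tapp d -> c = d.
Proof.
case: c d => [[[c1 c2] c3] c4] [[[d1 d2] d3] d4] eq_cd.
move: (eq_cd false false) (eq_cd false true) (eq_cd true false) (eq_cd true true).
by move=> /= -> -> -> ->.
Qed.

Lemma tconj0 : tconj false =1 id.
Proof. by case=> [[[? ?] ?] ?]. Qed.

Lemma tconjK (e : bool) : involutive (tconj e).
Proof. by move=> c; apply: tapp_inj => x y; rewrite !tapp_tabulate !addKb. Qed.

Lemma mem_tables (c : table) : c \in tables.
Proof. by case: c => [[[[] []] []] []]. Qed.

Definition tpair := (table * table)%type.

Definition tpairs : seq tpair := [seq (c, d) | c <- tables, d <- tables].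

Definition tpair_conj (e : bool) (D : tpair) : tpair := (tconj e D.1, tconj e D.2).

Definition teds := (tpair * tpair)%type.

Definition teds_conj (e : bool) (E : teds) : teds :=
  (tpair_conj e E.1, tpair_conj e E.2).

Lemma mem_tpairs (D : tpair) : D \in tpairs.
Proof. by case: D => c d; rewrite allpairs_f ?mem_tables. Qed.

Lemma tpair_conj0 : tpair_conj false =1 id.
Proof. by case=> c d; rewrite /tpair_conj !tconj0. Qed.

Lemma teds_conj0 : teds_conj false =1 id.
Proof. by case=> c d; rewrite /teds_conj !tpair_conj0. Qed.

Lemma tpair_conjK (e : bool) : involutive (tpair_conj e).
Proof. by case=> c d; rewrite /tpair_conj /= !tconjK. Qed.

Lemma teds_conjK (e : bool) : involutive (teds_conj e).
Proof. by case=> D E; rewrite /teds_conj /= !tpair_conjK. Qed.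

Definition all3 (p : bool -> bool -> bool -> bool) : bool :=
  all (fun x => all (fun y => all (p x y) bools) bools) bools.

Lemma all3P (p : bool -> bool -> bool -> bool) :
  reflect (forall x y z, p x y z) (all3 p).
Proof.
apply: (iffP idP) => [h x y z | h]; last by rewrite /all3 /= !h.
have in_bools t : t \in bools by case: t.
by apply: (allP (allP (allP h x _) y _) z _).
Qed.

Definition dias_table (D : tpair) : bool :=
  let l := tapp D.1 in let r := tapp D.2 in
  all3 (fun x y z =>
    [&& l (l x y) z == l x (l y z), l x (l y z) == l x (r y z),
        l (r x y) z == r x (l y z), r (r x y) z == r (l x y) z
      & r (l x y) z == r x (r y z)]).

Definition eds_table (E : teds) : bool :=
  let l := tapp E.1.1 in let r := tapp E.1.2 in
  let tl := tapp E.2.1 in let tr := tapp E.2.2 in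
  dias_table E.1 &&
  all3 (fun x y z =>
    [&& tr x (l y z) == tr x y,
        tl (r x y) z == tl y z,
        l (tl x y) (tl (l x y) z) == tl x (l y z),
        tl (tl x y) (tl (l x y) z) == tl y z,
        r (tl x y) (tl (l x y) z) == tl x (r y z),
        tr (tl x y) (tl (l x y) z) == tr y z,
        l (tr x (r y z)) (tr y z) == tr (l x y) z,
        tl (tr x (r y z)) (tr y z) == tl x y,
        r (tr x (r y z)) (tr y z) == tr (r x y) z
      & tr (tr x (r y z)) (tr y z) == tr x y]).

Definition nondegenerate_table (E : teds) : bool :=
  let l := tapp E.1.1 in let r := tapp E.1.2 in
  let tl := tapp E.2.1 in let tr := tapp E.2.2 in
  uniq [seq (l p.1 p.2, tl p.1 p.2) | p <- bool_pairs] &&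
  uniq [seq (r p.1 p.2, tr p.1 p.2) | p <- bool_pairs].

Lemma dias_tableP (D : tpair) :
  reflect (diassociative (tapp D.1) (tapp D.2)) (dias_table D).
Proof.
apply: (iffP (all3P _)) => [h | [h1 h2 h3 h4 h5] x y z]; last first.
  by apply/and5P; split; apply/eqP.
by split=> x y z; case/and5P: (h x y z) => /eqP ? /eqP ? /eqP ? /eqP ? /eqP ?.
Qed.

Lemma eds_tableP (E : teds) :
  reflect (extended_diassociative (tapp E.1.1) (tapp E.1.2) (tapp E.2.1) (tapp E.2.2))
          (eds_table E).
Proof.
apply: (iffP andP) => [[/dias_tableP h0 /all3P h] | [/dias_tableP h0]]; last first.
  move=> h1 h2 h3 h4 h5 h6 h7 h8 h9 h10; split=> //; apply/all3P=> x y z.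
  by do ![apply/andP; split]; apply/eqP.
(* There are ten equations: nine are split off and the tenth is what remains. *)
split=> // x y z; have := h x y z; do 9![case/andP=> /eqP ?]; by move/eqP.
Qed.

(** A self-map of a finite set is bijective as soon as it is injective, that is, when its list of
    values has no repetition. [bool_pairs] agrees with the canonical enumeration up to a
    permutation, which does not affect this. *)
Lemma bool_pair_bijP (f : bool * bool -> bool * bool) :
  reflect (bijective f) (uniq [seq f p | p <- bool_pairs]).
Proof.
have enum_pairs : perm_eq (enum {: bool * bool}) bool_pairs.
  by apply: uniq_perm => [||p]; rewrite ?enum_uniq // mem_enum; case: p => -[] [].
rewrite -(perm_uniq (perm_map f enum_pairs)).
by apply: (iffP (injectiveP f)) => [/injF_bij | /bij_inj].
Qed.

Lemma nondegenerate_tableP (E : teds) :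
  reflect (nondegenerate_ops (tapp E.1.1) (tapp E.1.2) (tapp E.2.1) (tapp E.2.2))
          (nondegenerate_table E).
Proof. by apply: (iffP andP) => -[/bool_pair_bijP h1 /bool_pair_bijP h2]. Qed.

Definition dias_tables : seq tpair := [seq D <- tpairs | dias_table D].

(** Only the diassociative pairs are extended, which leaves 13 * 256 candidates to test instead of
    256 * 256. *)
Definition eds_tables : seq teds :=
  [seq E <- [seq (D, D') | D <- dias_tables, D' <- tpairs] | eds_table E].

Lemma mem_dias_tables (D : tpair) : (D \in dias_tables) = dias_table D.
Proof. by rewrite mem_filter mem_tpairs andbT. Qed.

Lemma mem_eds_tables (E : teds) : (E \in eds_tables) = eds_table E.
Proof.
rewrite mem_filter andb_idr // => /andP[h0 _].
by case: E h0 => D D' h0; rewrite allpairs_f ?mem_tpairs ?mem_dias_tables.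
Qed.

(** * Tables of the named operations, and the lists of representatives *)

Definition tca := tabulate (fun _ _ => false).
Definition tcb := tabulate (fun _ _ => true).
Definition tp1 := tabulate (fun x _ => x).
Definition tp2 := tabulate (fun _ y => y).
(** With a read as [false] and b as [true], min is conjunction, while $m_1$, which takes the value a
    on the diagonal, is exclusive or, and $m_2$ is the equality test. *)
Definition tmin := tabulate andb.
Definition tm1 := tabulate addb.
Definition tm2 := tabulate (@eq_op bool).

Definition dias_reps : seq tpair :=
  [:: (tca, tca); (tca, tp2); (tmin, tmin); (tp1, tca);
      (tp1, tp1); (tp1, tp2); (tp2, tp2); (tm1, tm1)].

Definition eds_reps : seq teds :=
  let A := (tca, tca) in let B := (tca, tp2) in let C := (tmin, tmin) in
  let D := (tp1, tca) in let E := (tp1, tp1) in let F := (tp1, tp2) in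
  let G := (tp2, tp2) in let H := (tm1, tm1) in
  [:: (A, (tca, tca)); (A, (tp2, tp1));
      (B, (tca, tca)); (B, (tp2, tp1));
      (C, (tca, tca)); (C, (tca, tcb)); (C, (tp2, tp1)); (C, (tcb, tca)); (C, (tcb, tcb));
      (D, (tca, tca)); (D, (tp2, tp1));
      (E, (tca, tca)); (E, (tca, tcb)); (E, (tp2, tp1));
      (F, (tca, tca)); (F, (tca, tcb)); (F, (tp2, tp1)); (F, (tm1, tm1)); (F, (tm1, tm2));
      (G, (tca, tca)); (G, (tca, tcb)); (G, (tp2, tp1));
      (H, (tca, tca)); (H, (tp2, tp1))].

(** * Finite checks, in the form required by the orbit lemmas *)

Lemma dias_tables_uniq : uniq dias_tables.
Proof. by vm_compute. Qed.

Lemma size_dias_tables : size dias_tables = 13.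
Proof. by vm_compute. Qed.

Lemma dias_reps_uniq : uniq dias_reps.
Proof. by vm_compute. Qed.

Lemma dias_reps_tables : all [in dias_tables] dias_reps.
Proof. by vm_compute. Qed.

Lemma dias_reps_cover :
  all (fun k => (k \in dias_reps) || (tpair_conj true k \in dias_reps)) dias_tables.
Proof. by vm_compute. Qed.

(** The conclusion of the implication allows for self-conjugate pairs such as [(tp1, tp1)], whose
    conjugate is listed because it is the pair itself. *)
Lemma dias_reps_sep :
  all (fun k => (tpair_conj true k \in dias_reps) ==> (tpair_conj true k == k)) dias_reps.
Proof. by vm_compute. Qed.

Lemma eds_tables_uniq : uniq eds_tables.
Proof. by vm_compute. Qed.

Lemma size_eds_tables : size eds_tables = 45.
Proof. by vm_compute. Qed.

Lemma eds_reps_uniq : uniq eds_reps.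
Proof. by vm_compute. Qed.

Lemma eds_reps_tables : all [in eds_tables] eds_reps.
Proof. by vm_compute. Qed.

Lemma eds_reps_cover :
  all (fun k => (k \in eds_reps) || (teds_conj true k \in eds_reps)) eds_tables.
Proof. by vm_compute. Qed.

Lemma eds_reps_sep :
  all (fun k => (teds_conj true k \in eds_reps) ==> (teds_conj true k == k)) eds_reps.
Proof. by vm_compute. Qed.

(** * Decoding tables *)

Section Decoding.
Variables (Omega : finType) (a b : Omega).
Hypotheses (card_Omega : #|Omega| = 2) (neq_ab : a != b).

Definition point (t : bool) : Omega := if t then b else a.

Definition dec_op (c : table) : binop Omega :=
  [ffun p => point (tapp c (p.1 == b) (p.2 == b))].

Definition dec_dias (D : tpair) : dias_data Omega := (dec_op D.1, dec_op D.2).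

Definition dec_eds (E : teds) : eds_data Omega := (dec_dias E.1, dec_dias E.2).

Lemma pointK : cancel point (eq_op^~ b).
Proof. by case; rewrite /= ?eqxx // (negPf neq_ab). Qed.

(** The cardinality enters here: the distinct points [a] and [b] exhaust [Omega]. *)
Lemma point_eqb : cancel (eq_op^~ b) point.
Proof.
have Omega_ab : [set a; b] = [set: Omega].
  by apply/eqP; rewrite eqEcard subsetT cardsT card_Omega cards2 neq_ab.
move=> x; rewrite /point; case: eqP => // /eqP x_neq_b.
by move: (in_setT x); rewrite -Omega_ab !inE (negPf x_neq_b) orbF => /eqP.
Qed.

Lemma dec_opE (c : table) (x y : bool) :
  dec_op c (point x, point y) = point (tapp c x y).
Proof. by rewrite ffunE /= !pointK. Qed.

(** The transport lemmas only pull properties back, so an equivalence needs injective morphisms both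
    ways: [point] here, and comparison with [b] in [dec_op_eqb]. *)
Lemma dec_op_point (c : table) : {morph point : x y / tapp c x y >-> curry (dec_op c) x y}.
Proof. by move=> x y; rewrite /curry dec_opE. Qed.

Lemma dec_op_eqb (c : table) :
  {morph eq_op^~ b : x y / curry (dec_op c) x y >-> tapp c x y}.
Proof. by move=> x y; rewrite /curry ffunE pointK. Qed.

Lemma dec_op_inj : injective dec_op.
Proof.
move=> c d eq_cd; apply: tapp_inj => x y; apply: (can_inj pointK).
by rewrite -!dec_opE eq_cd.
Qed.

Lemma dec_dias_inj : injective dec_dias.
Proof. by move=> [c1 c2] [d1 d2] [/dec_op_inj-> /dec_op_inj->]. Qed.

Lemma dec_eds_inj : injective dec_eds.
Proof. by move=> [D1 D2] [E1 E2] [] *; congr (_, _); apply: dec_dias_inj; congr (_, _). Qed.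

Lemma dec_op_surj (o : binop Omega) : exists c, o = dec_op c.
Proof.
exists (tabulate (fun x y => o (point x, point y) == b)).
by apply/ffunP=> -[x y]; rewrite ffunE tapp_tabulate !point_eqb.
Qed.

Lemma dec_dias_surj (D : dias_data Omega) : exists c, D = dec_dias c.
Proof.
by case: D => l r; have [[c ->] [d ->]] := (dec_op_surj l, dec_op_surj r); exists (c, d).
Qed.

Lemma dec_eds_surj (E : eds_data Omega) : exists c, E = dec_eds c.
Proof.
case: E => D D'; have [[c ->] [d ->]] := (dec_dias_surj D, dec_dias_surj D').
by exists (c, d).
Qed.

(** The axioms are pulled back along [point] in one direction and along [eq_op^~ b] in the other. *)
Lemma is_dias_dec (D : tpair) : is_dias (dec_dias D) <-> dias_table D.
Proof.
split=> [h | /dias_tableP]; [apply/dias_tableP; move: h |];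
  apply: diassociative_inj;
  by [exact: can_inj pointK | exact: can_inj point_eqb
     | exact: dec_op_point | exact: dec_op_eqb].
Qed.

Lemma is_eds_dec (E : teds) : is_eds (dec_eds E) <-> eds_table E.
Proof.
split=> [h | /eds_tableP]; [apply/eds_tableP; move: h |];
  apply: extended_diassociative_inj;
  by [exact: can_inj pointK | exact: can_inj point_eqb
     | exact: dec_op_point | exact: dec_op_eqb].
Qed.

Lemma nondegenerate_dec (E : teds) : nondegenerate (dec_eds E) <-> nondegenerate_table E.
Proof.
split=> [h | /nondegenerate_tableP]; [apply/nondegenerate_tableP; move: h |];
  apply: nondegenerate_ops_inj;
  by [exact: can_inj pointK | exact: can_inj point_eqb
     | exact: dec_op_point | exact: dec_op_eqb].
Qed.

Lemma dias_structures_dec : dias_structures Omega = [set:: map dec_dias dias_tables].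
Proof.
apply/setP=> D; have [c ->] := dec_dias_surj D.
rewrite !in_set (mem_map dec_dias_inj) mem_dias_tables.
by apply/asboolP/idP => /is_dias_dec.
Qed.

Lemma eds_structures_dec : eds_structures Omega = [set:: map dec_eds eds_tables].
Proof.
apply/setP=> E; have [c ->] := dec_eds_surj E.
rewrite !in_set (mem_map dec_eds_inj) mem_eds_tables.
by apply/asboolP/idP => /is_eds_dec.
Qed.

(** * Bijections of the two-element set and isomorphisms *)

Definition flip (e : bool) (x : Omega) : Omega := point (e (+) (x == b)).

Lemma flip_bij (e : bool) : bijective (flip e).
Proof. by exists (flip e) => x; rewrite /flip pointK addKb point_eqb. Qed.

(** The image of [a] determines the bijection: it fixes [e], and injectivity leaves only the other
    point as the image of [b]. *)
Lemma bij_flip (f : Omega -> Omega) : bijective f -> exists e, f = flip e.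
Proof.
move/bij_inj=> f_inj; exists (f a == b); apply: funext => x.
rewrite -[f x]point_eqb /flip; congr point; rewrite -[x in LHS]point_eqb.
case: (x == b) => /=; last by rewrite addbF.
(* The case of [b] remains: [f a] and [f b] differ, hence so do the booleans encoding them. *)
rewrite addbT; have := inj_eq f_inj a b; rewrite (negPf neq_ab).
rewrite -(inj_eq (can_inj point_eqb)) /=.
by case: (f a == b) (f b == b) => -[].
Qed.

(** Since xor with [e] is its own inverse, the morphism equation can be solved for [c]. *)
Lemma op_morph_flip (e : bool) (c d : table) :
  op_morph (flip e) (dec_op c) (dec_op d) <-> c = tconj e d.
Proof.
split=> [h | -> x y].
  apply: tapp_inj => x y; rewrite tapp_tabulate.
  have := h (point x) (point y).
  rewrite /flip !pointK !dec_opE pointK => /(can_inj pointK) <-.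
  by rewrite addKb.
by rewrite /flip dec_opE ffunE pointK tapp_tabulate addKb.
Qed.

(** A single flip must carry both operations, so the two possible flips account for the two
    disjuncts. This is hypothesis [RE] of the orbit lemmas, with [tpair_conj true] as the
    involution. *)
Lemma dias_isomorphic_dec (D D' : tpair) :
  `[< dias_isomorphic (dec_dias D) (dec_dias D') >] = (D == D') || (D == tpair_conj true D').
Proof.
apply/asboolP/idP => [[f [/bij_flip[e ->] /op_morph_flip h1 /op_morph_flip h2]] | h].
  have -> : D = tpair_conj e D' by case: D h1 h2 => c d /= -> ->.
  by case: e {h1 h2}; rewrite ?tpair_conj0 eqxx ?orbT.
have [e ->] : exists e, D = tpair_conj e D'.
  by case/orP: h => /eqP->; [exists false; rewrite tpair_conj0 | exists true].
by exists (flip e); split; [exact: flip_bij | exact/op_morph_flip..].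
Qed.

Lemma eds_isomorphic_dec (E E' : teds) :
  `[< eds_isomorphic (dec_eds E) (dec_eds E') >] = (E == E') || (E == teds_conj true E').
Proof.
apply/asboolP/idP => [[f [/bij_flip[e ->]]] | h].
  move=> /op_morph_flip h1 /op_morph_flip h2 /op_morph_flip h3 /op_morph_flip h4.
  have -> : E = teds_conj e E' by case: E h1 h2 h3 h4 => [[? ?] [? ?]] /= -> -> -> ->.
  by case: e {h1 h2 h3 h4}; rewrite ?teds_conj0 eqxx ?orbT.
have [e ->] : exists e, E = teds_conj e E'.
  by case/orP: h => /eqP->; [exists false; rewrite teds_conj0 | exists true].
by exists (flip e); split; [exact: flip_bij | exact/op_morph_flip..].
Qed.

(** * The named operations as decoded tables *)

Lemma cst_op_a_dec : cst_op a = dec_op tca.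
Proof. by apply/ffunP=> p; rewrite !ffunE tapp_tabulate. Qed.

Lemma cst_op_b_dec : cst_op b = dec_op tcb.
Proof. by apply/ffunP=> p; rewrite !ffunE tapp_tabulate. Qed.

Lemma p1_op_dec : p1_op Omega = dec_op tp1.
Proof. by apply/ffunP=> p; rewrite !ffunE tapp_tabulate point_eqb. Qed.

Lemma p2_op_dec : p2_op Omega = dec_op tp2.
Proof. by apply/ffunP=> p; rewrite !ffunE tapp_tabulate point_eqb. Qed.

Lemma min_op_dec : min_op a b = dec_op tmin.
Proof. by apply/ffunP=> -[x y]; rewrite !ffunE tapp_tabulate. Qed.

Lemma m1_op_dec : m1_op a b = dec_op tm1.
Proof.
(* Equality of two points becomes equality of their booleans, and four cases remain. *)
apply/ffunP=> p; rewrite !ffunE tapp_tabulate -(inj_eq (can_inj point_eqb)).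
by case: (p.1 == b) (p.2 == b) => -[].
Qed.

Lemma m2_op_dec : m2_op a b = dec_op tm2.
Proof. by apply/ffunP=> p; rewrite !ffunE tapp_tabulate -(inj_eq (can_inj point_eqb)). Qed.

(** * Counting and transversals on [Omega] *)

Lemma dias_classification :
  [/\ #|dias_structures Omega| = 13, #|dias_classes Omega| = 8 &
      is_transversal [set:: map dec_dias dias_reps]
        (dias_classes Omega) (dias_structures Omega)].
Proof.
(* This is the relation defining [dias_classes], named so that it can serve as [R] in the orbit
   lemmas. *)
pose iso (D D' : dias_data Omega) := `[< dias_isomorphic D D' >].
have isoE D D' : iso (dec_dias D) (dec_dias D') = _ := dias_isomorphic_dec D D'.
have conjK := @tpair_conjK true; have S_dec := dias_structures_dec.
split.
- by rewrite S_dec (card_set_map_dec dec_dias_inj dias_tables_uniq) size_dias_tables.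
- exact: (card_orbit_classes dec_dias_inj conjK isoE S_dec dias_reps_uniq dias_reps_tables
            dias_reps_cover dias_reps_sep).
- exact: (orbit_transversal dec_dias_inj conjK isoE S_dec dias_reps_tables
            dias_reps_cover dias_reps_sep).
Qed.

Lemma eds_classification :
  [/\ #|eds_structures Omega| = 45, #|eds_classes Omega| = 24 &
      is_transversal [set:: map dec_eds eds_reps]
        (eds_classes Omega) (eds_structures Omega)].
Proof.
pose iso (E E' : eds_data Omega) := `[< eds_isomorphic E E' >].
have isoE E E' : iso (dec_eds E) (dec_eds E') = _ := eds_isomorphic_dec E E'.
have conjK := @teds_conjK true; have S_dec := eds_structures_dec.
split.
- by rewrite S_dec (card_set_map_dec dec_eds_inj eds_tables_uniq) size_eds_tables.
- exact: (card_orbit_classes dec_eds_inj conjK isoE S_dec eds_reps_uniq eds_reps_tables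
            eds_reps_cover eds_reps_sep).
- exact: (orbit_transversal dec_eds_inj conjK isoE S_dec eds_reps_tables
            eds_reps_cover eds_reps_sep).
Qed.

(** Decoding is injective and preserves and reflects nondegeneracy, so the selection can be made on
    tables, where it is computable. *)
Lemma nondegenerate_set (r : seq teds) :
  [set S in map dec_eds r | `[< nondegenerate S >]] =
  [set:: map dec_eds [seq E <- r | nondegenerate_table E]].
Proof.
apply/setP=> S; have [E ->] := dec_eds_surj S.
rewrite !inE !(mem_map dec_eds_inj) mem_filter andbC; congr andb.
by apply/asboolP/idP => /nondegenerate_dec.
Qed.

End Decoding.

Theorem mainTheorem11 (Omega : finType) (a b : Omega)
    (card_Omega : #|Omega| = 2) (neq_ab : a != b) :
  let ca := cst_op a in let cb := cst_op b in
  let p1 := p1_op Omega in let p2 := p2_op Omega in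
  let mn := min_op a b in let m1 := m1_op a b in let m2 := m2_op a b in
  let A : dias_data Omega := (ca, ca) in
  let B : dias_data Omega := (ca, p2) in
  let C : dias_data Omega := (mn, mn) in
  let D : dias_data Omega := (p1, ca) in
  let E : dias_data Omega := (p1, p1) in
  let F : dias_data Omega := (p1, p2) in
  let G : dias_data Omega := (p2, p2) in
  let H : dias_data Omega := (m1, m1) in
  let dias_reps : seq (dias_data Omega) := [:: A; B; C; D; E; F; G; H] in
  let eds_reps : seq (eds_data Omega) :=
    [:: (A, (ca, ca)); (A, (p2, p1));
        (B, (ca, ca)); (B, (p2, p1));
        (C, (ca, ca)); (C, (ca, cb)); (C, (p2, p1)); (C, (cb, ca)); (C, (cb, cb));
        (D, (ca, ca)); (D, (p2, p1));
        (E, (ca, ca)); (E, (ca, cb)); (E, (p2, p1));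
        (F, (ca, ca)); (F, (ca, cb)); (F, (p2, p1)); (F, (m1, m1)); (F, (m1, m2));
        (G, (ca, ca)); (G, (ca, cb)); (G, (p2, p1));
        (H, (ca, ca)); (H, (p2, p1))] in
  [/\ #|dias_structures Omega| = 13 /\ #|dias_classes Omega| = 8,
      #|eds_structures Omega| = 45 /\ #|eds_classes Omega| = 24,
      is_transversal [set:: dias_reps] (dias_classes Omega) (dias_structures Omega),
      is_transversal [set:: eds_reps] (eds_classes Omega) (eds_structures Omega) &
      let nondeg := [set S in eds_reps | `[< nondegenerate S >]] in
      nondeg = [set:: [:: (F, (p2, p1)); (F, (m1, m1)); (F, (m1, m2)); (H, (p2, p1))]]
      /\ #|nondeg| = 4].
Proof.
move=> ca cb p1 p2 mn m1 m2; rewrite /ca /cb /p1 /p2 /mn /m1 /m2.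
(* Once every named operation is a decoded table, the two lists of the statement are the images of
   the table lists under [dec_dias] and [dec_eds]. *)
rewrite (cst_op_a_dec a b) (cst_op_b_dec a b) min_op_dec.
rewrite !(p1_op_dec card_Omega neq_ab) !(p2_op_dec card_Omega neq_ab).
rewrite !(m1_op_dec card_Omega neq_ab) !(m2_op_dec card_Omega neq_ab).
have [dcard dclasses dtransv] := dias_classification card_Omega neq_ab.
have [ecard eclasses etransv] := eds_classification card_Omega neq_ab.
have nondegE := nondegenerate_set card_Omega neq_ab eds_reps.
have nondeg_reps : [seq K <- eds_reps | nondegenerate_table K] =
    [:: (tp1, tp2, (tp2, tp1)); (tp1, tp2, (tm1, tm1));
        (tp1, tp2, (tm1, tm2)); (tm1, tm1, (tp2, tp1))] by vm_compute.
rewrite nondeg_reps in nondegE.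
split=> //; split; first exact: nondegE.
apply: etrans (congr1 (fun X : {set _} => #|X|) nondegE) _.
(* By injectivity of the decoding, the cardinality is the length of the list of four distinct
   tables. *)
by rewrite (card_set_map_dec (dec_eds_inj neq_ab)).
Qed.
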